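(* Let $(\diamondsuit,\rho)$ be a compact discrete Riemann surface of genus $g$ with canonical dissection $\aleph$, associated cycles $\aleph^\Lambda_1,\dots,\aleph^\Lambda_{4g}$ on $\Lambda$, and dual basis of real harmonic forms $\alpha_1,\dots,\alpha_{4g}$. Let $B,C$ be the lower left and lower right $2g\times 2g$ blocks of the matrix $\big((\alpha_k,\alpha_\ell)\big)_{1\le k,\ell\le 4g}=\begin{pmatrix} A & D \\ B & C \end{pmatrix}$. Then the matrix $\Pi=C^{-1}\cdot(i\,I-B)$ is the period matrix, in the canonical dissection, of the basis of holomorphic forms $$\zeta_k:=(i-* )\sum_{\ell=1}^{2g}(C^{-1})_{k,\ell}\,\alpha_{\ell+2g},\qquad 1\le k\le 2g;$$ that is, $(\zeta_k)_{1\le k\le 2g}$ is a basis of the complex vector space of holomorphic $1$-forms on $\Lambda$, and for $1\le\ell\le 2g$ $$\oint_{\aleph^\Lambda_k}\zeta_\ell=\begin{cases}\delta_{k,\ell}&\text{for }1\le k\le 2g,\\ \Pi_{k-2g,\ell}&\text{for }2g<k\le 4g.\end{cases}$$ Moreover $\Pi$ is symmetric, with a positive definite imaginary part.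
   Context: $\diamondsuit$ is a finite cellular decomposition of a compact connected oriented surface of genus $g$ all of whose faces are quadrilaterals and whose vertices are split into two classes $\Gamma_0$ and $\Gamma^*_0$ such that every edge of $\diamondsuit$ joins the two classes. The diagonals of the faces joining vertices of $\Gamma_0$ (resp. $\Gamma_0^*$) are the edges of a cellular decomposition $\Gamma$ (resp. $\Gamma^*$) of the surface; $\Gamma$ and $\Gamma^*$ are dual, and $\Lambda=\Gamma\sqcup\Gamma^*$ is the double, with edge set $\Lambda_1$. The two diagonals of a face are dual edges: for a face $(x,y,x',y')$ with vertices in counterclockwise order, $(x,x')^*=(y,y')$ and $(y,y')^*=(x',x)$ as oriented edges. $\rho$ is a positive function on unoriented edges of $\Lambda$ with $\rho(e^* )=1/\rho(e)$. A $1$-form on $\Lambda$ is a complex-valued function on oriented edges of $\Lambda$, odd under orientation reversal, written $\int_e\alpha$. It is closed ($d\alpha=0$) if its sum around every face of $\Gamma$ and of $\Gamma^*$ is zero. Hodge star: $\int_e*\alpha=-\rho(e^* )\int_{e^*}\alpha$, so $*^2=-1$. $\alpha$ is harmonic if $\alpha$ and $*\alpha$ are closed; it is holomorphic if $d\alpha=0$ and $*\alpha=-i\alpha$. Scalar product: $(\alpha,\beta)=\sum_{e\in\Lambda_1}\rho(e)\left(\int_e\alpha\right)\overline{\left(\int_e\beta\right)}$ (sum over unoriented edges). A canonical dissection is a family of cycles $\aleph_1,\dots,\aleph_{2g}$ of edges of $\diamondsuit$ forming a basis of the first homology, obtained by adding edges $e_1,\dots,e_{2g}$ to a maximal tree $T$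 of edges of $\diamondsuit$ ($\aleph_k\subset T\cup e_k$), with algebraic intersection numbers, for $1\le k,\ell\le g$, $\aleph_k\cdot\aleph_\ell=0$, $\aleph_{k+g}\cdot\aleph_{\ell+g}=0$, $\aleph_k\cdot\aleph_{\ell+g}=\delta_{k,\ell}$ (usual sign convention: on a torus with $a$, $b$ in the positive $x$ and $y$ directions, $a\cdot b=1$). $\aleph^\Gamma_k$, $\aleph^{\Gamma^*}_k$ denote cycles of edges of $\Gamma$, $\Gamma^*$ homologous on the surface to $\aleph_k$. For $1\le k\le g$: $\aleph^\Lambda_k=\aleph^\Gamma_k$, $\aleph^\Lambda_{k+g}=\aleph^{\Gamma^*}_k$, $\aleph^\Lambda_{k+2g}=\aleph^{\Gamma^*}_{k+g}$, $\aleph^\Lambda_{k+3g}=\aleph^{\Gamma}_{k+g}$. $(\alpha_k)_{1\le k\le 4g}$ is the basis of real harmonic $1$-forms on $\Lambda$ dual to these cycles: $\oint_{\aleph^\Lambda_k}\alpha_\ell=\delta_{k,\ell}$ for $1\le k,\ell\le 4g$. *)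

(* Defs.v *)
From HB Require Import structures.
From mathcomp Require Import all_boot all_order all_algebra.
From mathcomp Require Import complex.
From mathcomp Require Import reals.

Set Implicit Arguments.
Unset Strict Implicit.
Unset Printing Implicit Defensive.

Import Order.TTheory GRing.Theory Num.Theory.
Local Open Scope ring_scope.
Local Open Scope complex_scope.

(* A cellular decomposition of a compact connected oriented surface into
   quadrilaterals with 2-coloured vertices, given as a combinatorial map.
   A dart is an oriented edge x -> y of the quad-graph; [opp] reverses it, and
   [face] sends it to the next dart, counterclockwise, along the boundary of the
   face on its left. [inG d] says that the origin of [d] is in Gamma_0 rather than
   in Gamma^*_0; vertices, edges and faces are the orbits of [node]
   below, of [opp] and of [face]. *)
Record quadmap := QuadMap {
  dart :> finType;
  opp : dart -> dart;
  face : dart -> dart;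
  inG : dart -> bool;
  dart_nonempty : (0 < #|dart|)%N;
  opp_invol : involutive opp;
  opp_free : forall d, opp d != d;
  face_inj : injective face;
  face_quad : forall d, order face d = 4%N;
  inG_opp : forall d, inG (opp d) = ~~ inG d;
  inG_face : forall d, inG (face d) = ~~ inG d;
  dart_connected :
    forall d d', connect (fun x y => (y == opp x) || (y == face x)) d d'
}.

Section Combinatorics.
Variable M : quadmap.
Implicit Types (d : M) (c w : M -> int).

(* The next dart, counterclockwise, with the same origin. *)
Definition node d : M := opp (finv (@face M) d).

(* Euler's formula: V - E + F = 2 - 2g. *)
Definition has_genus (g : nat) : Prop :=
  (fcard node M + fcard (@face M) M + 2 * g = fcard (@opp M) M + 2)%N.

(* A dart d = (x -> y) of the face (x, y, x', y') also encodes the oriented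
   diagonal (x, x'), which is an oriented edge of Gamma if [inG d] and of
   Gamma^* otherwise. Every oriented edge of the double Lambda is obtained once
   in this way; since [face d] = (y -> x') and [face (face d)] = (x' -> y'),
   the dual (x, x')^* = (y, y') is [face d], and the reversal (x', x) is
   [face (face d)]; hence also (y, y')^* = (x', x). *)
Definition dualL d : M := face d.
Definition revL d : M := face (face d).

(* Integral 1-chains of the quad-graph and of Lambda are functions on oriented
   edges that are odd under reversal. The oriented edges of the quad-graph
   issuing from a vertex, as well as those of Lambda, are the darts in a
   [node]-orbit, so both cases have the same boundary condition. *)
Definition zero_boundary c : Prop := forall d, \sum_(d' | fconnect node d d') c d' = 0.

Definition quad_cycle c : Prop := (forall d, c (opp d) = - c d) /\ zero_boundary c.

Definition Gamma_cycle (b : bool) c : Prop :=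
  [/\ forall d, c (revL d) = - c d,
      forall d, inG d != b -> c d = 0
    & zero_boundary c].

(* The chain c is the boundary of the 2-chain w (a function on faces). *)
Definition quad_boundary c : Prop :=
  exists2 w, forall d, w (face d) = w d & forall d, c d = w d - w (opp d).

Definition homology_basis n (a : 'I_n -> M -> int) : Prop :=
  [/\ forall k, quad_cycle (a k),
      forall z : 'I_n -> int,
        quad_boundary (fun d => \sum_k z k * a k d) -> forall k, z k = 0
    & forall c, quad_cycle c -> exists z : 'I_n -> int,
        quad_boundary (fun d => c d - \sum_k z k * a k d)].

(* A cycle a of the quad-graph and a cycle c of Gamma (b = true) or of
   Gamma^* (b = false) are homologous on the surface: cutting every face along
   its diagonal of class b gives a decomposition of the surface which contains
   both cycles as 1-chains; its triangles (x, y, x') are indexed by the darts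
   d = (x -> y) with [inG d = b], and a - c is the boundary of the 2-chain w of
   these triangles. The edge x -> y has the triangle of d on its left and that
   of [finv face (opp d)] on its right; the diagonal (x, x') has the triangle
   of [revL d] on its left and that of d on its right. *)
Definition homologous (b : bool) (a c : M -> int) : Prop :=
  exists w : M -> int, forall d, inG d = b ->
    a d = w d - w (finv (@face M) (opp d)) /\ - c d = w (revL d) - w d.

(* Algebraic intersection number of two cycles a, b of the quad-graph. At a
   vertex with darts d_0, ..., d_(m-1) in counterclockwise order, the
   contribution is the half sum of a(d_i) b(d_j) - a(d_j) b(d_i) over i < j; it
   does not depend on the choice of d_0, because a and b have zero boundary,
   and is the average of the numbers of crossings obtained by pushing b
   slightly to the left and to the right. If a comes from the west and leaves
   to the east, and b comes from the south and leaves to the north, the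
   contribution is 1. *)
Definition intersection (a b : M -> int) : rat :=
  2^-1 * (\sum_(d in froots node) \sum_(j < order node d) \sum_(i < j)
            (a (iter i node d) * b (iter j node d)
             - a (iter j node d) * b (iter i node d)))%:~R.

Definition spanning_tree (T : {set M}) : Prop :=
  [/\ forall d, (opp d \in T) = (d \in T),
      forall d d',
        connect (fun x y => (y == node x) || (x \in T) && (y == opp x)) d d'
    & forall c, quad_cycle c -> (forall d, d \notin T -> c d = 0) ->
        forall d, c d = 0].

(* The cycles aleph_k and aleph_(k+g), for 1 <= k <= g, are indexed by
   [lshift g k] and [rshift g k]. *)
Record canonical_dissection g (aleph : 'I_(g + g) -> M -> int) : Prop := {
  dissection_basis : homology_basis aleph;
  dissection_tree : exists T : {set M}, exists e : 'I_(g + g) -> M,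
    [/\ spanning_tree T,
        forall k, e k \notin T
      & forall k d, d \notin T -> d != e k -> d != opp (e k) -> aleph k d = 0];
  dissection_aa : forall k l : 'I_g,
    intersection (aleph (lshift g k)) (aleph (lshift g l)) = 0;
  dissection_bb : forall k l : 'I_g,
    intersection (aleph (rshift g k)) (aleph (rshift g l)) = 0;
  dissection_ab : forall k l : 'I_g,
    intersection (aleph (lshift g k)) (aleph (rshift g l)) = (k == l)%:R
}.

(* The cycles aleph^Lambda; [cG] and [cGs] are the families of cycles of Gamma
   and of Gamma^*, and the four blocks of size g are in the order of [split]. *)
Definition alephL g (cG cGs : 'I_(g + g) -> M -> int)
    (k : 'I_((g + g) + (g + g))) : M -> int :=
  match split k with
  | inl j => match split j with
             | inl i => cG (lshift g i)
             | inr i => cGs (lshift g i)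
             end
  | inr j => match split j with
             | inl i => cGs (rshift g i)
             | inr i => cG (rshift g i)
             end
  end.

End Combinatorics.

Definition conformal (R : realType) (M : quadmap) (rho : M -> R) : Prop :=
  [/\ forall d, 0 < rho d,
      forall d, rho (revL d) = rho d
    & forall d, rho (dualL d) = (rho d)^-1].

(* [v] is a basis of the subspace of vectors satisfying [P]. *)
Definition is_basis (K : fieldType) (V : vectType K) (P : V -> Prop) n
    (v : 'I_n -> V) : Prop :=
  free [tuple v k | k < n] /\
  forall u, u \in <<[tuple v k | k < n]>>%VS <-> P u.

Definition posdefmx (R : realType) n (A : 'M[R]_n) : Prop :=
  forall v : 'cV[R]_n, v != 0 -> 0 < (v^T *m A *m v) 0 0.

Section Forms.
Variables (R : realType) (M : quadmap) (rho : M -> R).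

(* Functions on the oriented edges of Lambda; 1-forms are those satisfying
   [form1]. The regular modules [R[i]^o] and [R^o] provide the vector space
   structures over [R[i]] and [R]. *)
Notation cform := {ffun M -> R[i]^o}.
Notation rform := {ffun M -> R^o}.
Implicit Types a b : cform.

Definition form1 a : Prop := forall d, a (revL d) = - a d.

(* The face of Gamma^* or Gamma dual to a vertex v is bounded,
   counterclockwise, by the duals of the edges of Lambda issuing from v. *)
Definition closed_form a : Prop :=
  forall d, \sum_(d' | fconnect (@node M) d d') a (dualL d') = 0.

Definition hodge a : cform := [ffun d => - ((rho (dualL d))%:C * a (dualL d))].

Definition harmonic a : Prop := [/\ form1 a, closed_form a & closed_form (hodge a)].

Definition holomorphic a : Prop :=
  [/\ form1 a, closed_form a & hodge a = - 'i%C *: a].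

Definition complexify (r : rform) : cform := [ffun d => (r d)%:C].

Definition real_harmonic (r : rform) : Prop := harmonic (complexify r).

(* In the next two definitions every unoriented edge is counted twice, once
   for each orientation. *)
Definition oint (c : M -> int) a : R[i] := 2^-1 * \sum_d (c d)%:~R * a d.

Definition sprod a b : R[i] := 2^-1 * \sum_d (rho d)%:C * a d * (b d)^*.

End Forms.

(* Main.v *)
Require Import Defs.
From HB Require Import structures.
From mathcomp Require Import all_boot all_order all_algebra.
From mathcomp Require Import complex.
From mathcomp Require Import reals.
From mathcomp Require Import boolp ring.
(* Restores [opp] as the reversal of darts. *)
Import Defs.

(** The heart of the matter is a Riemann bilinear relation for the double: for
    closed 1-forms a, b on Lambda, with periods P_k (along the first 2g cycles
    aleph^Lambda) and Q_k (along the last 2g),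
      1/2 sum_d a(d) b(d^* ) = sum_k (P_k(a) Q_k(b) - Q_k(a) P_k(b)).
    The left-hand side is the wedge product of a and b; as the Hodge star is
    essentially the passage to the dual edge, the scalar product (a, b) is the
    wedge product of a with the star of the conjugate of b. On the dual basis
    the relation therefore says that the entries of the Gram matrix are, up to
    sign, the periods of the forms [hodge rho alpha_l]; in particular the block
    C is, up to sign, the matrix of the P-periods of the stars of
    alpha_(2g+1), ..., alpha_(4g), and B that of the stars of
    alpha_1, ..., alpha_(2g). The periods of zeta follow by linearity. The
    matrix C is real, symmetric and positive definite, being a Gram matrix of
    independent real forms, hence so is Im Pi = C^-1. The star preserves the
    wedge product, which gives B C = C B^T, that is, the symmetry of Pi. Finally
    a holomorphic form with vanishing P-periods has norm zero by the bilinear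
    relation, so that the zeta_k, which have unit P-periods, form a basis
    ([dual_basis]).

    To prove the bilinear relation ([bilinear_double]), a closed form on Gamma
    (resp. Gamma^* ) is first lifted to a closed form on the quad-graph whose
    integral along a diagonal is the sum of the integrals along two sides
    ([quad_lift]); homologous cycles give it the same periods
    ([homologous_period]). This reduces the question to closed forms u, v on
    the quad-graph ([bilinear_quad]). There, a cycle c has a Poincare dual
    closed form: choose h on the corners of the faces, jumping by c(d) when the
    dart d is crossed, and take the differences of h along each face
    ([corner_diff]). Its wedge product with v, keeping only the diagonals of one class in
    the first factor, is minus the integral of v along c
    ([pairing_corner_diff]), and its integral along a cycle c' is the
    intersection number of c and c' ([period_intersection]). Subtracting from u
    the combination of duals of the aleph_k which has the same periods leaves a
    form without periods, which is exact because the surface is connected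
    ([zero_period_exact]); an exact form is the dual of the zero cycle, so it
    does not contribute ([poincare_dual]). *)

Import Order.TTheory GRing.Theory Num.Theory.
Local Open Scope ring_scope.
Local Open Scope complex_scope.

Set Implicit Arguments.
Unset Strict Implicit.
Unset Printing Implicit Defensive.

(** * Sums along orbits *)

Lemma sum_orbit (T : finType) (V : nmodType) (f : T -> T) (F : T -> V) x :
  \sum_(y | fconnect f x y) F y = \sum_(j < order f x) F (iter j f x).
Proof.
transitivity (\sum_(y <- orbit f x) F y).
  rewrite big_uniq ?orbit_uniq //.
  by apply: eq_bigl => y; rewrite -fconnect_orbit.
rewrite (big_nth x) size_orbit big_mkord.
by apply: eq_bigr => j _; rewrite nth_traject.
Qed.

Lemma sum_froots (T : finType) (V : nmodType) (f : T -> T) (F : T -> V) :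
  injective f ->
  \sum_x F x = \sum_(r in froots f) \sum_(j < order f r) F (iter j f r).
Proof.
move=> f_inj.
have sym : connect_sym (frel f) by exact: fconnect_sym.
rewrite (partition_big (froot f) (mem (froots f))) /=; last first.
  by move=> x _; exact: roots_root.
apply: eq_bigr => r /eqP r_root; rewrite -sum_orbit.
by apply: eq_bigl => x; rewrite -(root_connect sym) eq_sym r_root.
Qed.

(** The partial sums of g from a root of the orbit define h; the vanishing of
    the total sum makes the definition consistent when the orbit closes up. *)
Lemma orbit_primitive (T : finType) (V : zmodType) (f : T -> T) (g : T -> V) :
  injective f -> (forall x, \sum_(y | fconnect f x y) g y = 0) ->
  exists h, forall x, h (f x) = h x + g x.
Proof.
move=> f_inj g0.
have sym : connect_sym (frel f) by exact: fconnect_sym.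
exists (fun x => \sum_(i < findex f (froot f x) x) g (iter i f (froot f x))) => x.
have -> : froot f (f x) = froot f x.
  by apply/eqP; rewrite root_connect // sym fconnect1.
set r := froot f x.
have rx : fconnect f r x by rewrite sym connect_root.
have lt_n := findex_max rx; have := iter_findex rx.
set n := findex f r x in lt_n *; move=> xE.
have fxE : f x = iter n.+1 f r by rewrite /= xE.
case: (ltngtP n.+1 (order f r)) lt_n => // [lt_n1|n1E] _.
  have -> : findex f r (f x) = n.+1 by rewrite fxE findex_iter.
  by rewrite big_ord_recr /= xE.
have -> : f x = r by rewrite fxE n1E iter_order.
rewrite findex0 big_ord0; have := g0 r.
by rewrite sum_orbit -n1E big_ord_recr /= xE.
Qed.

(** * Darts and their permutations *)

Section Darts.
Variable M : quadmap.
Implicit Type d : M.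

Lemma oppK d : opp (opp d) = d. Proof. exact: opp_invol. Qed.

Lemma face4 d : face (face (face (face d))) = d.
Proof. by have := iter_order (@face_inj M) d; rewrite face_quad. Qed.

Lemma node_face d : node (face d) = opp d.
Proof. by rewrite /node finv_f //; exact: face_inj. Qed.

Lemma nodeE d : node d = opp (face (face (face d))).
Proof. by rewrite -{1}[d]face4 node_face. Qed.

Lemma node_inj : injective (@node M).
Proof.
by move=> d e; rewrite !nodeE => /(can_inj oppK) /face_inj /face_inj /face_inj.
Qed.

Lemma inG_node d : inG (node d) = inG d.
Proof. by rewrite nodeE inG_opp !inG_face !negbK. Qed.

End Darts.

(** * Closed forms and cycles on the quad-graph *)

Section Cohomology.
Variables (K : numFieldType) (M : quadmap).
Implicit Types (d : M) (u v h : M -> K) (c : M -> int).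

Lemma sum_halves (F : M -> K) b :
  (forall d, F (opp d) = F d) -> \sum_d F d = 2 * \sum_(d | inG d == b) F d.
Proof.
move=> Fopp; rewrite (bigID (fun d => inG d == b)) /= mulr_natl mulr2n.
congr (_ + _); rewrite (reindex_inj (can_inj (@oppK M))).
by apply: eq_big => [d|d _]; rewrite ?Fopp // inG_opp; case: (inG d); case: b.
Qed.

Lemma reindex_face2 (F : M -> K) b :
  \sum_(d | inG d == b) F d = \sum_(d | inG d == b) F (face (face d)).
Proof.
rewrite (reindex_inj (inj_comp (@face_inj M) (@face_inj M))) /=.
by apply: eq_bigl => d; rewrite !inG_face negbK.
Qed.

Lemma reindex_node (F : M -> K) b :
  \sum_(d | inG d == b) F d = \sum_(d | inG d == b) F (node d).
Proof.
by rewrite (reindex_inj (@node_inj M)); apply: eq_bigl => d; rewrite inG_node.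
Qed.

Definition closed_quad u : Prop :=
  (forall d, u (opp d) = - u d) /\
  (forall d, u d + u (face d) + u (face (face d)) + u (face (face (face d))) = 0).

(** For complex values this is [oint], up to conversion. *)
Definition period c u : K := 2^-1 * \sum_d (c d)%:~R * u d.

(** The dart d stands for the corner at its origin of the face on its left, so
    that this is a difference of values of h at consecutive corners of a face. *)
Definition corner_diff h d : K := h d - h (face d).

(** The left-hand side is twice the part of the wedge product of [corner_diff h]
    and v in which the first form is taken on the diagonals of class b and the
    second one on their duals. The formula is a summation by parts: closedness
    of v turns the differences of h within faces into the differences of h
    around vertices, which are the values of c. *)
Lemma pairing_corner_diff b h (c : M -> K) v :
    (forall d, c (opp d) = - c d) -> (forall d, h (node d) = h d + c (node d)) ->
    closed_quad v ->
  \sum_(d | inG d == b) (corner_diff h d + corner_diff h (face d))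
                        * (v (face d) + v (face (face d)))
  = - \sum_d c d * v d.
Proof.
move=> c_odd hc [v_odd v_closed].
have nodeV d : v (face (face (face d))) = - v (node d).
  by rewrite nodeE v_odd opprK.
rewrite (eq_bigr (fun d => h d * (v (face d) + v (face (face d)))
           - h (face (face d)) * (v (face d) + v (face (face d))))); last first.
  by move=> d _; rewrite /corner_diff; ring.
rewrite sumrB [X in _ - X](reindex_face2) -sumrB.
rewrite (eq_bigr (fun d => - 2 * (h d * v d - h d * v (node d)))); last first.
  move=> d _; rewrite face4 nodeV.
  by have := v_closed d; rewrite nodeV => /eqP; rewrite subr_eq0 => /eqP <-; ring.
rewrite -mulr_sumr sumrB reindex_node -sumrB.
rewrite (eq_bigr (fun d => c (node d) * v (node d))); last first.
  by move=> d _; rewrite hc; ring.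
rewrite -(reindex_node (fun d => c d * v d)) (sum_halves b) ?mulNr //.
by move=> d; rewrite c_odd v_odd mulrNN.
Qed.

(** An edge with left face F and right face F' has one corner in each of F and F'
    at either end. The difference of h computed in F' agrees with the one
    computed in F because the jumps at both ends of the edge are opposite. *)
Lemma corner_diff_odd h (c : M -> K) d :
    (forall d, c (opp d) = - c d) -> (forall d, h (node d) = h d + c (node d)) ->
  corner_diff h (opp d) = - corner_diff h d.
Proof.
move=> c_odd hc; rewrite /corner_diff.
have := hc (face (opp d)); rewrite node_face oppK => ->.
by have := hc (face d); rewrite node_face c_odd => ->; ring.
Qed.

Lemma corner_diff_closed h (c : M -> K) :
    (forall d, c (opp d) = - c d) -> (forall d, h (node d) = h d + c (node d)) ->
  closed_quad (corner_diff h).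
Proof.
move=> c_odd hc; split=> d; first exact: corner_diff_odd hc.
by rewrite /corner_diff face4; ring.
Qed.

(** A potential on the corners around each vertex, jumping by c across each
    edge; it exists because c has zero boundary. *)
Lemma cycle_primitive c : quad_cycle c ->
  exists h, forall d, h (node d) = h d + (c (node d))%:~R.
Proof.
move=> [_ c0].
have [d|h hE] := @orbit_primitive _ K _ (fun d => (c (node d))%:~R) (@node_inj M).
  have := congr1 (fun z => z%:~R : K) (c0 d); rewrite rmorph_sum /= => /(etrans _); apply.
  rewrite [RHS](reindex_inj (@node_inj M)).
  by apply: eq_bigl => e; rewrite -same_fconnect1_r //; exact: node_inj.
by exists h.
Qed.

Lemma square_sum n (a b : nat -> K) :
  (\sum_(j < n) a j) * (\sum_(j < n) b j) =
  \sum_(j < n) (\sum_(i < j) (a i * b j + a j * b i) + a j * b j).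
Proof.
elim: n => [|n IH]; first by rewrite !big_ord0 mul0r.
rewrite !big_ord_recr /= -IH big_split /= -mulr_suml -mulr_sumr; ring.
Qed.

(** At a vertex with darts d_0, d_1, ..., the value of h is a constant plus the
    partial sums of c, so the local contribution is the sum of c(d_i) c'(d_j)
    over i < j plus half the sum of c(d_i) c'(d_i). The half sum in the
    definition of [intersection] differs from it by half the product of the
    total sums of c and c', which are zero ([square_sum]). *)
Lemma period_intersection c c' h : quad_cycle c -> quad_cycle c' ->
    (forall d, h (node d) = h d + (c (node d))%:~R) ->
  period c' (corner_diff h) = ratr (intersection c c').
Proof.
move=> [c_odd c0] [c'_odd c'0] hc.
rewrite /period /intersection rmorphM /= fmorphV rmorph_nat; congr (_ * _).
rewrite ratr_int.
pose x d : K := (c d)%:~R; pose y d : K := (c' d)%:~R.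
(* The values of h on both sides of d enter symmetrically, as c' is odd. *)
have -> : \sum_d y d * corner_diff h d = \sum_d y d * (2 * h d - x d).
  rewrite (eq_bigr (fun d => y d * h d - y d * h (face d))) => [|d _]; last first.
    by rewrite /corner_diff; ring.
  rewrite sumrB [X in _ - X](reindex_inj (can_inj (@oppK M))) -sumrB.
  apply: eq_bigr => d _; rewrite /y c'_odd rmorphN /=.
  have := hc (face (opp d)); rewrite node_face oppK => ->; rewrite -/(x d); ring.
rewrite (sum_froots _ (@node_inj M)) rmorph_sum; apply: eq_bigr => r _ /=.
pose X i := x (iter i (@node M) r); pose Y i := y (iter i (@node M) r).
have hE j : h (iter j (@node M) r) = h r - x r + \sum_(i < j) X i + X j.
  elim: j => [|j IH]; first by rewrite big_ord0 /X /=; ring.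
  by rewrite iterS hc IH big_ord_recr /= !addrA.
have Y0 : \sum_(j < order (@node M) r) Y j = 0.
  rewrite -(sum_orbit (@node M) y) /y; have := c'0 r.
  by move=> /(congr1 (fun z => z%:~R : K)); rewrite rmorph_sum.
have XY := square_sum (order (@node M) r) X Y; rewrite Y0 mulr0 in XY.
rewrite rmorph_sum /=.
transitivity (\sum_(j < order (@node M) r)
    (Y j * (2 * (h r - x r)) + (2 * (\sum_(i < j) X i) * Y j + X j * Y j))).
  by apply: eq_bigr => j _; rewrite hE -/(X j) -/(Y j); ring.
rewrite big_split /= -mulr_suml Y0 mul0r add0r.
apply/eqP; rewrite -subr_eq0 -sumrB [X in _ == X]XY; apply/eqP.
apply: eq_bigr => j _; rewrite rmorph_sum /=.
under [X in _ - X]eq_bigr => i _ do rewrite rmorphB !rmorphM /=.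
rewrite sumrB big_split /= -!mulr_sumr -!mulr_suml; ring.
Qed.

Lemma closed_quadB u v : closed_quad u -> closed_quad v ->
  closed_quad (fun d => u d - v d).
Proof.
move=> [uo uc] [vo vc]; split=> d; first by rewrite uo vo; ring.
by rewrite -[RHS](subr0 0) -{1}(uc d) -(vc d); ring.
Qed.

Lemma closed_quadZ (x : K) u : closed_quad u -> closed_quad (fun d => x * u d).
Proof.
move=> [uo uc]; split=> d; first by rewrite uo mulrN.
by rewrite -[RHS](mulr0 x) -(uc d); ring.
Qed.

Lemma closed_quad_sum (I : finType) (U : I -> M -> K) :
  (forall i, closed_quad (U i)) -> closed_quad (fun d => \sum_i U i d).
Proof.
move=> Uc; split=> d.
  by rewrite -sumrN; apply: eq_bigr => i _; case: (Uc i).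
by rewrite -!big_split big1 //= => i _; case: (Uc i).
Qed.

Lemma periodB c u v : period c (fun d => u d - v d) = period c u - period c v.
Proof.
rewrite /period -mulrBr -sumrB; congr (_ * _).
by apply: eq_bigr => d _; rewrite mulrBr.
Qed.

Lemma periodZ (x : K) c u : period c (fun d => x * u d) = x * period c u.
Proof.
rewrite /period [RHS]mulrCA; congr (_ * _); rewrite mulr_sumr.
by apply: eq_bigr => d _; rewrite mulrCA.
Qed.

Lemma period_sum (I : finType) c (U : I -> M -> K) :
  period c (fun d => \sum_i U i d) = \sum_i period c (U i).
Proof.
rewrite /period -mulr_sumr exchange_big /=; congr (_ * _).
by apply: eq_bigr => d _; rewrite mulr_sumr.
Qed.

(** Each face contributes its weight w times the sum of u around it; averaging
    over the four rotations of the faces makes these sums appear. *)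
Lemma period_boundary c u : quad_boundary c -> closed_quad u -> period c u = 0.
Proof.
move=> [w w_face cE] [u_odd u_closed]; rewrite /period.
pose W d : K := (w d)%:~R.
have rot F : \sum_d W d * F d = \sum_d W d * F (face d).
  rewrite (reindex_inj (@face_inj M)).
  by apply: eq_bigr => d _; rewrite /W w_face.
have S0 : \sum_d W d * u d = 0.
  have n4 : 4%:R != 0 :> K by rewrite pnatr_eq0.
  apply: (mulfI n4); rewrite mulr0.
  have -> : 4%:R * \sum_d W d * u d = \sum_d W d * u d + \sum_d W d * u d
      + \sum_d W d * u d + \sum_d W d * u d by ring.
  rewrite [X in _ + X + _ + _]rot [X in _ + _ + X + _]rot.
  rewrite [X in _ + _ + X + _]rot 3![X in _ + _ + _ + X]rot.
  rewrite -!big_split big1 //= => d _.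
  by rewrite -!mulrDr u_closed mulr0.
rewrite (eq_bigr (fun d => W d * u d + W (opp d) * u (opp d))) => [|d _]; last first.
  by rewrite cE rmorphB /= u_odd -/(W d) -/(W (opp d)); ring.
rewrite big_split S0 /= add0r; apply/eqP; rewrite mulf_eq0; apply/orP; right.
apply/eqP.
by apply: etrans S0; rewrite [RHS](reindex_inj (can_inj (@oppK M))).
Qed.

(** The 1-chain of a single oriented edge. *)
Definition step (x : M) : M -> int := fun d => (d == x)%:Z - (d == opp x)%:Z.

Lemma step_odd x d : step x (opp d) = - step x d.
Proof.
by rewrite /step (can2_eq (@oppK M) (@oppK M)) (inj_eq (can_inj (@oppK M))) opprB.
Qed.

Lemma sum_step x e : \sum_(d | fconnect (@node M) e d) step x d
  = (fconnect (@node M) e x)%:Z - (fconnect (@node M) e (opp x))%:Z.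
Proof.
have one y : \sum_(d | fconnect (@node M) e d) (d == y)%:Z
    = (fconnect (@node M) e y)%:Z.
  case: (boolP (fconnect (@node M) e y)) => ey.
    rewrite (bigD1 y) //= eqxx big1 // => d /andP[_ /negPf->]//.
  by rewrite big1 // => d ed; case: eqP => // dy; rewrite -dy ed in ey.
by rewrite sumrB !one.
Qed.

Lemma period_step x u : (forall d, u (opp d) = - u d) -> period (step x) u = u x.
Proof.
move=> u_odd; rewrite /period.
rewrite (bigD1 x) //= (bigD1 (opp x)) ?opp_free //= big1; last first.
  move=> d /andP[dx dox]; rewrite /step (negPf dx) (negPf dox) subrr mul0r //.
rewrite /step !eqxx [x == _]eq_sym (negPf (opp_free x)) u_odd subr0 sub0r addr0.
by rewrite rmorphN mulrNN !mul1r -mulr2n -[u x *+ 2]mulr_natl mulKf // pnatr_eq0.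
Qed.

(** The chain of a path of darts from d0 to d; its boundary is the difference of
    the two origins. *)
Lemma path_chain (d0 d : M) : exists c : M -> int,
  (forall e, c (opp e) = - c e) /\
  forall e, \sum_(d' | fconnect (@node M) e d') c d'
    = (fconnect (@node M) e d0)%:Z - (fconnect (@node M) e d)%:Z.
Proof.
have /connectP[p] := dart_connected d0 d.
elim/last_ind: p d => [|p y IH] d /=.
  move=> _ ->; exists (fun=> 0); split=> [e|e]; first by rewrite /= oppr0.
  by rewrite big1 //= subrr.
rewrite rcons_path last_rcons => /andP[p_path step_y] ->{d}.
have [c [c_odd c_sum]] := IH _ p_path erefl.
set x := last d0 p in step_y c_sum.
exists (fun d => c d + step x d); split=> e; first by rewrite c_odd step_odd [RHS]opprD.
rewrite big_split /= c_sum sum_step addrA subrK.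
congr (_ - (nat_of_bool _)%:Z).
(* Both moves lead from x to the end of the edge x. *)
case/orP: step_y => /eqP -> //.
by rewrite (same_fconnect1_r (@node_inj M) e (face x)) node_face.
Qed.

(** Integration along paths from a base dart. Two paths with the same ends differ
    by a cycle, so the primitive only depends on the origin of a dart, which is
    the invariance of h under [node]. *)
Lemma zero_period_exact u : closed_quad u ->
    (forall c, quad_cycle c -> period c u = 0) ->
  exists2 h, (forall d, h (node d) = h d) & forall d, u d = corner_diff h d.
Proof.
move=> [u_odd u_closed] per0.
have /card_gt0P[d0 _] := dart_nonempty M.
have [C CP] := choice (path_chain d0).
have uniq_per c c' : (forall d, c (opp d) = - c d) -> (forall d, c' (opp d) = - c' d) ->
    (forall e, \sum_(d' | fconnect (@node M) e d') c d'
             = \sum_(d' | fconnect (@node M) e d') c' d') -> period c u = period c' u.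
  move=> co c'o cc'.
  have /per0 : quad_cycle (fun d => c d - c' d).
    by split=> d; [rewrite co c'o opprD | rewrite sumrB cc' subrr].
  move=> p0; apply/eqP; rewrite -subr_eq0 -p0 /period -mulrBr -sumrB.
  apply/eqP; congr (_ * _).
  by apply: eq_bigr => d _; rewrite rmorphB mulrBl.
exists (fun d => - period (C d) u) => d.
  congr (- _); have [o1 s1] := CP d; have [o2 s2] := CP (node d).
  apply: uniq_per => // e; rewrite s1 s2.
  by rewrite -(same_fconnect1_r (@node_inj M)).
have [o1 s1] := CP d; have [o2 s2] := CP (face d).
rewrite /corner_diff opprK.
have -> : period (C (face d)) u = period (fun e => C d e + step d e) u.
  apply: uniq_per => // e; first by rewrite o1 step_odd [RHS]opprD.
  rewrite big_split /= s1 s2 sum_step addrA subrK.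
  by rewrite (same_fconnect1_r (@node_inj M) e (face d)) node_face.
rewrite -[LHS](period_step d u_odd) addrC /period -mulrBr -sumrB; congr (_ * _).
by apply: eq_bigr => e _; rewrite (intrD K (C d e)); ring.
Qed.

Lemma basis_period0 n (a : 'I_n -> M -> int) u : homology_basis a ->
    closed_quad u -> (forall k, period (a k) u = 0) ->
  forall c, quad_cycle c -> period c u = 0.
Proof.
move=> [_ _ a_span] u_closed a0 c /a_span[z /period_boundary/(_ u_closed)].
rewrite /period; under eq_bigr => d _ do rewrite rmorphB mulrBl.
rewrite sumrB mulrBr => /eqP; rewrite subr_eq0 => /eqP ->.
rewrite (eq_bigr (fun d => \sum_k (z k)%:~R * ((a k d)%:~R * u d))); last first.
  move=> d _; rewrite rmorph_sum mulr_suml; apply: eq_bigr => k _.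
  by rewrite rmorphM mulrA.
rewrite exchange_big mulr_sumr big1 //= => k _.
by rewrite -mulr_sumr mulrCA -/(period (a k) u) a0 mulr0.
Qed.

Lemma intersectionC (c c' : M -> int) : intersection c c' = - intersection c' c.
Proof.
rewrite /intersection -mulrN -rmorphN; congr (_ * _%:~R).
rewrite -sumrN; apply: eq_bigr => d _; rewrite -sumrN; apply: eq_bigr => j _.
rewrite -sumrN; apply: eq_bigr => i _; rewrite opprB.
by rewrite [c _ * _]mulrC [X in _ - X]mulrC.
Qed.

Section Dissection.
Variables (g : nat) (a : 'I_(g + g) -> M -> int).
Hypothesis a_dissection : canonical_dissection a.

Let A k := a (lshift g k).
Let B k := a (rshift g k).

(** A closed form u has the same periods as the combination of the duals of A_k
    and B_k with the coefficients below, by the intersection numbers of the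
    dissection; the difference is exact, and is absorbed in h. *)
Lemma poincare_dual u : closed_quad u -> exists h,
  (forall d, u d = corner_diff h d) /\
  forall d, h (node d) = h d +
    \sum_k (period (B k) u * (A k (node d))%:~R - period (A k) u * (B k (node d))%:~R).
Proof.
move=> u_closed.
have [a_basis _ iAA iBB iAB] := a_dissection.
have a_cycle k : quad_cycle (a k) by case: a_basis.
have [H HP] := choice (fun k => cycle_primitive (a_cycle k)).
have H_closed k : closed_quad (corner_diff (H k)).
  apply: corner_diff_closed (fun d => (a k d)%:~R) _ (HP k) => d.
  by case: (a_cycle k) => -> _; rewrite rmorphN.
pose w d := u d - \sum_k (period (B k) u * corner_diff (H (lshift g k)) d
                        - period (A k) u * corner_diff (H (rshift g k)) d).
have w_closed : closed_quad w.
  apply: closed_quadB => //; apply: closed_quad_sum => k.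
  by apply: closed_quadB; apply: closed_quadZ.
have perH k l : period (a l) (corner_diff (H k)) = ratr (intersection (a k) (a l)).
  exact: period_intersection.
have w0 k : period (a k) w = 0.
  rewrite periodB period_sum.
  under eq_bigr => l _ do rewrite periodB !periodZ !perH.
  case: (splitP k) => j kE.
    have -> : k = lshift g j by exact: val_inj.
    rewrite (bigD1 j) //= big1 => [|l lj].
      by rewrite iAA intersectionC iAB eqxx rmorph0 rmorphN rmorph1 -/(A j); ring.
    by rewrite iAA intersectionC iAB eq_sym (negPf lj) oppr0 !rmorph0 !mulr0 subr0.
  have -> : k = rshift g j by exact: val_inj.
  rewrite (bigD1 j) //= big1 => [|l lj].
    by rewrite iBB iAB eqxx rmorph0 rmorph1 -/(B j); ring.
  by rewrite iBB iAB (negPf lj) !rmorph0 !mulr0 subr0.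
have [h0 h0_node wE] := zero_period_exact w_closed (basis_period0 a_basis w_closed w0).
exists (fun d => h0 d + \sum_k (period (B k) u * H (lshift g k) d
                        - period (A k) u * H (rshift g k) d)); split=> d.
  rewrite /corner_diff opprD addrACA -sumrB -/(corner_diff h0 d) -wE /w.
  rewrite [X in _ = _ + X](eq_bigr (fun k => period (B k) u * corner_diff (H (lshift g k)) d
                        - period (A k) u * corner_diff (H (rshift g k)) d)).
    by rewrite subrK.
  by move=> k _; rewrite /corner_diff; ring.
rewrite h0_node -addrA -big_split; congr (_ + _).
by apply: eq_bigr => k _; rewrite /= !HP; ring.
Qed.

(** As u is the Poincare dual of a combination of the A_k and B_k, its wedge
    product with v is a combination of the periods of v. *)
Lemma bilinear_quad b u v : closed_quad u -> closed_quad v ->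
  \sum_(d | inG d == b) (u d + u (face d)) * (v (face d) + v (face (face d)))
  = 2 * \sum_k (period (A k) u * period (B k) v - period (B k) u * period (A k) v).
Proof.
move=> u_closed v_closed; have [h [uE hE]] := poincare_dual u_closed.
have a_cycle k : quad_cycle (a k) by case: (dissection_basis a_dissection).
pose c d := \sum_k (period (B k) u * (A k d)%:~R - period (A k) u * (B k d)%:~R).
have c_odd d : c (opp d) = - c d.
  rewrite /c -sumrN; apply: eq_bigr => k _.
  by rewrite /A /B (proj1 (a_cycle _)) (proj1 (a_cycle _)) !rmorphN /=; ring.
rewrite (eq_bigr (fun d => (corner_diff h d + corner_diff h (face d))
                        * (v (face d) + v (face (face d))))); last first.
  by move=> d _; rewrite !uE.
rewrite (@pairing_corner_diff b h c v) //.
rewrite (eq_bigr (fun d => \sum_k (period (B k) u * ((A k d)%:~R * v d)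
                        - period (A k) u * ((B k d)%:~R * v d)))); last first.
  by move=> d _; rewrite /c mulr_suml; apply: eq_bigr => k _; rewrite mulrBl !mulrA.
rewrite exchange_big /= -sumrN mulr_sumr; apply: eq_bigr => k _.
have per x : \sum_d (x d)%:~R * v d = 2 * period x v by rewrite mulVKf // pnatr_eq0.
by rewrite sumrB -!mulr_sumr !per; ring.
Qed.

End Dissection.

(** * Closed forms on the double *)

Definition closed_double (A : M -> K) : Prop :=
  (forall d, A (revL d) = - A d) /\
  forall d, \sum_(d' | fconnect (@node M) d d') A (dualL d') = 0.

(** The neighbours of a vertex y of the class other than b are the corners of the
    face of the b-graph dual to y. As A is closed, it has a primitive H on the
    boundary of this face, which provides the value of u on the edges from y. *)
Lemma quad_lift b (A : M -> K) : closed_double A ->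
  exists2 u, closed_quad u & forall d, inG d = b -> A d = u d + u (face d).
Proof.
move=> [odd_A A_closed]; have A_odd d : A (face (face d)) = - A d := odd_A d.
have [H HE] := orbit_primitive (@node_inj M) A_closed.
pose u e := if inG e == b then - H (opp e) else H e.
have uA d : inG d = b -> A d = u d + u (face d).
  move=> db; rewrite /u inG_face db eqxx; have -> : (~~ b == b) = false by case: (b).
  have := HE (face d); rewrite node_face => ->.
  by rewrite /dualL A_odd opprB subrK.
exists u => //; split=> d.
  rewrite /u inG_opp oppK; case: (inG d); case: (b); by rewrite ?opprK.
have ur e : u e + u (face e) + u (face (face e)) + u (face (face (face e))) = 0 ->
  u (face e) + u (face (face e)) + u (face (face (face e)))
  + u (face (face (face (face e)))) = 0.
  by rewrite face4 => <-; ring.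
have u0 e : inG e = b -> u e + u (face e) + u (face (face e)) + u (face (face (face e))) = 0.
  move=> eb; rewrite -uA // -addrA -uA ?inG_face ?negbK //.
  by rewrite A_odd subrr.
case: (boolP (inG d == b)) => [/eqP/u0 //|db].
rewrite -[d]face4; apply: ur; apply: u0; rewrite !inG_face.
by move: db; case: (inG d); case: (b).
Qed.

(** Both periods are equal to the sum of w(d) A(d) over the oriented diagonals
    of class b, where w is the 2-chain realizing the homology: on its edges in the
    quad-graph, w meets u on the two sides of each triangle, and u adds up to A. *)
Lemma homologous_period b (a c : M -> int) (A : M -> K) u :
    quad_cycle a -> Gamma_cycle b c -> homologous b a c -> closed_quad u ->
    (forall d, inG d = b -> A d = u d + u (face d)) ->
  period c A = period a u.
Proof.
move=> [a_odd _] [c_odd c_supp _] [w wE] [u_odd u_closed] uA; congr (_ * _).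
pose W d : K := (w d)%:~R.
have A_odd d : inG d = b -> A (face (face d)) = - A d.
  move=> db; apply/eqP; rewrite -addr_eq0 addrC !uA ?inG_face ?negbK //.
  by rewrite addrA u_closed.
have -> : \sum_d (c d)%:~R * A d = \sum_(d | inG d == b) (W d - W (face (face d))) * A d.
  rewrite [RHS]big_mkcond; apply: eq_bigr => d _.
  case: (boolP (inG d == b)) => [/eqP db|db]; last by rewrite c_supp ?mul0r.
  have [_ cE] := wE _ db; rewrite -[c d]opprK cE -rmorphB /=.
  by rewrite opprB.
have -> : \sum_(d | inG d == b) (W d - W (face (face d))) * A d
    = 2 * \sum_(d | inG d == b) W d * A d.
  rewrite (eq_bigr (fun d => W d * A d + W (face (face d)) * A (face (face d)))).
    by rewrite big_split /= -(reindex_face2 (fun d => W d * A d)); ring.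
  by move=> d /eqP db; rewrite A_odd //; ring.
rewrite (sum_halves b) => [|d]; last by rewrite a_odd u_odd rmorphN mulrNN.
congr (_ * _); symmetry.
rewrite (eq_bigr (fun d => W d * u d - W (finv (@face M) (opp d)) * u d)) => [|d]; last first.
  by move=> /eqP/wE[-> _]; rewrite rmorphB mulrBl.
rewrite sumrB [X in _ - X](reindex_inj (inj_comp (can_inj (@oppK M)) (@face_inj M))) /=.
rewrite [X in _ - X](eq_bigl (fun d => inG d == b)); last first.
  by move=> d; rewrite inG_opp inG_face negbK.
rewrite -sumrB; apply: eq_bigr => d /eqP db.
rewrite oppK finv_f; last exact: face_inj.
by rewrite u_odd uA //; ring.
Qed.

Section DoubleDissection.
Variables (g : nat) (a cG cGs : 'I_(g + g) -> M -> int).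
Hypothesis a_dissection : canonical_dissection a.
Hypothesis cG_cycle : forall k, Gamma_cycle true (cG k).
Hypothesis cG_homologous : forall k, homologous true (a k) (cG k).
Hypothesis cGs_cycle : forall k, Gamma_cycle false (cGs k).
Hypothesis cGs_homologous : forall k, homologous false (a k) (cGs k).

Let P (k : 'I_(g + g)) := period (alephL cG cGs (lshift (g + g) k)).
Let Q (k : 'I_(g + g)) := period (alephL cG cGs (rshift (g + g) k)).

(** The wedge product of A and B is the sum of a term pairing A on Gamma with B
    on Gamma^* and of a term pairing A on Gamma^* with B on Gamma; each is given
    by [bilinear_quad] applied to lifts. *)
Lemma bilinear_double (A B : M -> K) : closed_double A -> closed_double B ->
  2^-1 * \sum_d A d * B (face d) = \sum_k (P k A * Q k B - Q k A * P k B).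
Proof.
move=> A_closed B_closed.
have a_cycle k : quad_cycle (a k) by case: (dissection_basis a_dissection).
have [uG uG_closed uGE] := quad_lift true A_closed.
have [uS uS_closed uSE] := quad_lift false A_closed.
have [vG vG_closed vGE] := quad_lift true B_closed.
have [vS vS_closed vSE] := quad_lift false B_closed.
have pG F f k : closed_quad f -> (forall d, inG d = true -> F d = f d + f (face d)) ->
  period (cG k) F = period (a k) f.
  by apply: homologous_period.
have pS F f k : closed_quad f -> (forall d, inG d = false -> F d = f d + f (face d)) ->
  period (cGs k) F = period (a k) f.
  by apply: homologous_period.
rewrite (bigID (fun d => inG d == true)) /=.
rewrite (eq_bigr (fun d => (uG d + uG (face d)) * (vS (face d) + vS (face (face d))))).
  rewrite (bilinear_quad a_dissection) //.
  rewrite [X in _ + X](eq_big (fun d => inG d == false)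
     (fun d => (uS d + uS (face d)) * (vG (face d) + vG (face (face d))))).
  - rewrite (bilinear_quad a_dissection) // -mulrDr mulKf ?pnatr_eq0 //.
    rewrite [RHS]big_split_ord /= -!big_split; apply: eq_bigr => k _ /=.
    have splitl m n (i : 'I_m) : split (lshift n i) = inl i := unsplitK (inl i).
    have splitr m n (i : 'I_n) : split (rshift m i) = inr i := unsplitK (inr i).
    rewrite /P /Q /alephL !(splitl, splitr).
    rewrite !(pG _ _ _ uG_closed uGE) !(pG _ _ _ vG_closed vGE).
    by rewrite !(pS _ _ _ uS_closed uSE) !(pS _ _ _ vS_closed vSE); ring.
  - by move=> d; case: (inG d).
  - by move=> d; case E: (inG d) => // _; rewrite uSE // vGE // inG_face E.
by move=> d /eqP E; rewrite uGE // vSE // inG_face E.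
Qed.

End DoubleDissection.
End Cohomology.

(** * Dual bases and positive definite matrices *)

(** The forms L_j separate the points of P, so u is equal to the combination of
    the v_k with coefficients L_k(u). *)
Lemma dual_basis (K : fieldType) (V : vectType K) (P : V -> Prop) n
    (v : 'I_n -> V) (L : 'I_n -> V -> K) :
    P 0 -> (forall x a b, P a -> P b -> P (x *: a + b)) ->
    (forall j x a b, L j (x *: a + b) = x * L j a + L j b) ->
    (forall k, P (v k)) -> (forall j k, L j (v k) = (j == k)%:R) ->
    (forall u, P u -> (forall j, L j u = 0) -> u = 0) ->
  is_basis P v.
Proof.
move=> P0 P_lin L_lin Pv Lv L0_eq0.
have L0 j : L j 0 = 0.
  by have := L_lin j (-1) 0 0; rewrite scaler0 addr0 mulN1r addNr.
have L_sum j (c : 'I_n -> K) : L j (\sum_k c k *: v k) = c j.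
  transitivity (\sum_k c k * L j (v k)).
    elim/big_rec2: _ => // k x u _ <-; exact: L_lin.
  rewrite (bigD1 j) //= Lv eqxx mulr1 big1 ?addr0 // => k kj.
  by rewrite Lv eq_sym (negPf kj) mulr0.
have P_sum (c : 'I_n -> K) : P (\sum_k c k *: v k).
  by elim/big_rec: _ => // k u _ Pu; exact: P_lin.
have vE (k : 'I_n) : [tuple v k | k < n]`_k = v k by rewrite -tnth_nth tnth_mktuple.
split.
  apply/freeP => c c0 j.
  have <- := L_sum j c; rewrite -[RHS](L0 j); congr (L j _); apply: etrans c0.
  by apply: eq_bigr => k _; rewrite vE.
move=> u; split=> [/coord_span ->|Pu].
  under eq_bigr => k _ do rewrite vE.
  exact: P_sum.
have /subr0_eq -> : u - \sum_k L k u *: v k = 0.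
  apply: L0_eq0 => [|j]; rewrite addrC -scaleN1r; first exact: P_lin.
  by rewrite L_lin L_sum mulN1r addNr.
apply: memv_suml => k _; apply/memvZ/memv_span.
by apply/tnthP; exists k; rewrite tnth_mktuple.
Qed.

Section PosDef.
Variables (R : realType) (n : nat) (A : 'M[R]_n).
Hypothesis A_pos : posdefmx A.

Lemma posdefmx_unit : A \in unitmx.
Proof.
rewrite unitmxE unitfE; apply/negP => /det0P[v v0 vA].
have : v^T != 0 by rewrite -trmx0 (inj_eq trmx_inj).
by move=> /A_pos; rewrite trmxK vA mul0mx mxE ltxx.
Qed.

Lemma posdefmx_inv : A^T = A -> posdefmx (invmx A).
Proof.
move=> A_sym v v0; have A_unit := posdefmx_unit.
have /A_pos : invmx A *m v != 0.
  by apply: contraNneq v0 => /(congr1 (mulmx A)); rewrite mulKVmx // mulmx0 => ->.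
by rewrite trmx_mul trmx_inv A_sym -!mulmxA mulKVmx.
Qed.

End PosDef.

(** * The Hodge star *)

Section Hodge.
Variables (R : realType) (M : quadmap) (rho : M -> R).
Hypothesis rho_conformal : conformal rho.
Implicit Types a b : {ffun M -> R[i]^o}.

Let rho_gt0 d : 0 < rho d. Proof. by case: rho_conformal. Qed.

Let rhoV d : (rho (face d))%:C * (rho d)%:C = 1.
Proof.
have [_ _ rhoV] := rho_conformal.
by rewrite (rhoV d) -rmorphM /= mulVf ?rmorph1 // gt_eqF.
Qed.

Lemma hodge_face a d : form1 a -> hodge rho a (face d) = (rho d)%:C * a d.
Proof.
have [_ rho_rev _] := rho_conformal.
by move=> a1; rewrite ffunE /dualL (a1 d) (rho_rev d) mulrN opprK.
Qed.

Lemma hodge_form1 a : form1 a -> form1 (hodge rho a).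
Proof.
move=> a1 d; rewrite /revL hodge_face // ffunE /dualL opprK //.
Qed.

Lemma hodgeK a : form1 a -> hodge rho (hodge rho a) = - a.
Proof.
move=> a1; apply/ffunP => d; rewrite ffunE /dualL hodge_face // [RHS]ffunE.
by rewrite mulrA rhoV mul1r.
Qed.

Lemma hodge_lin x a b : hodge rho (x *: a + b) = x *: hodge rho a + hodge rho b.
Proof.
apply/ffunP => d; rewrite !ffunE /GRing.scale /=; ring.
Qed.

Lemma hodge0 : hodge rho 0 = 0.
Proof. by apply/ffunP => d; rewrite !ffunE mulr0 oppr0. Qed.

Lemma hodge_sum (I : finType) (x : I -> R[i]) (u : I -> {ffun M -> R[i]^o}) :
  hodge rho (\sum_i x i *: u i) = \sum_i x i *: hodge rho (u i).
Proof.
by elim/big_rec2: _ => [|i _ a _ <-]; [exact: hodge0 | exact: hodge_lin].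
Qed.

Lemma form1_lin x a b : form1 a -> form1 b -> form1 (x *: a + b).
Proof. by move=> a1 b1 d; rewrite !ffunE a1 b1 scalerN opprD. Qed.

Lemma closed_lin x a b : closed_form a -> closed_form b -> closed_form (x *: a + b).
Proof.
move=> ac bc d; under eq_bigr => e _ do rewrite !ffunE.
by rewrite big_split /= -scaler_sumr ac bc scaler0 addr0.
Qed.

Lemma harmonic_lin x a b :
  harmonic rho a -> harmonic rho b -> harmonic rho (x *: a + b).
Proof.
move=> [a1 ac ahc] [b1 bc bhc]; split; first exact: form1_lin.
  exact: closed_lin.
by rewrite hodge_lin; exact: closed_lin.
Qed.

Lemma form0 : form1 (0 : {ffun M -> R[i]^o}) /\ closed_form (0 : {ffun M -> R[i]^o}).
Proof.
split=> d; first by rewrite !ffunE oppr0.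
by rewrite big1 // => e _; rewrite ffunE.
Qed.

Lemma harmonic0 : harmonic rho 0.
Proof. by have [f1 fc] := form0; split; rewrite ?hodge0. Qed.

Lemma holomorphic0 : holomorphic rho 0.
Proof. by have [f1 fc] := form0; split; rewrite ?hodge0 ?scaler0. Qed.

Lemma holomorphic_lin x a b :
  holomorphic rho a -> holomorphic rho b -> holomorphic rho (x *: a + b).
Proof.
move=> [a1 ac ah] [b1 bc bh]; split; first exact: form1_lin.
  exact: closed_lin.
by rewrite hodge_lin ah bh scalerDr !scalerA [x * _]mulrC.
Qed.

Lemma hodgeN a : hodge rho (- a) = - hodge rho a.
Proof. by rewrite -scaleN1r -[_ *: _]addr0 hodge_lin hodge0 addr0 scaleN1r. Qed.

Lemma harmonicN a : harmonic rho a -> harmonic rho (- a).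
Proof.
by move=> ha; rewrite -scaleN1r -[_ *: _]addr0; apply: harmonic_lin (harmonic0).
Qed.

Lemma harmonic_hodge a : harmonic rho a -> harmonic rho (hodge rho a).
Proof.
move=> ha; have [a1 _ ahc] := ha; have [_ Nac _] := harmonicN ha.
by split; rewrite ?hodgeK //; exact: hodge_form1.
Qed.

Lemma harmonic_holomorphic a :
  harmonic rho a -> holomorphic rho ('i%C *: a - hodge rho a).
Proof.
move=> ha; have [a1 _ _] := ha.
have [h1 hc _] := harmonic_lin 'i%C ha (harmonicN (harmonic_hodge ha)).
split=> //; rewrite hodge_lin hodgeN hodgeK // opprK scalerBr scalerA.
by rewrite mulNr -expr2 sqr_i opprK scale1r scaleNr opprK addrC.
Qed.

(** The star exchanges the two diagonals of every face, up to inverse factors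
    which cancel in the wedge product. *)
Lemma sum_hodge a b : form1 a -> form1 b ->
  \sum_d hodge rho a d * hodge rho b (face d) = \sum_d a d * b (face d).
Proof.
move=> a1 b1; rewrite [RHS](reindex_inj (@face_inj M)) /=.
apply: eq_bigr => d _; rewrite hodge_face // ffunE (b1 d) /dualL.
by rewrite mulrN mulNr; congr (- _); rewrite mulrACA rhoV mul1r.
Qed.

Lemma sum_norm_eq0 a : \sum_d (rho d)%:C * a d * (a d)^* = 0 -> a = 0.
Proof.
have ge0 d : 0 <= (rho d)%:C * a d * (a d)^*.
  by rewrite -mulrA mulr_ge0 ?mulcJ_ge0 // ler0c ltW.
move/eqP; rewrite psumr_eq0 // => /allP a0; apply/ffunP => d; rewrite ffunE.
have := a0 d (mem_index_enum d); rewrite !mulf_eq0 conjc_eq0 -orbA orbb /=.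
by rewrite fmorph_eq0 gt_eqF // => /eqP.
Qed.

End Hodge.

(** * The period matrix *)

Section PeriodMatrix.
Variables (R : realType) (M : quadmap) (g : nat) (rho : M -> R).
Variables (aleph alephG alephGs : 'I_(g + g) -> M -> int).
Variable alpha : 'I_((g + g) + (g + g)) -> {ffun M -> R^o}.
Hypothesis rho_conformal : conformal rho.
Hypothesis aleph_dissection : canonical_dissection aleph.
Hypothesis alephG_cycle : forall k, Gamma_cycle true (alephG k).
Hypothesis alephG_homologous : forall k, homologous true (aleph k) (alephG k).
Hypothesis alephGs_cycle : forall k, Gamma_cycle false (alephGs k).
Hypothesis alephGs_homologous : forall k, homologous false (aleph k) (alephGs k).
Hypothesis alpha_harmonic : forall k, harmonic rho (complexify (alpha k)).
Hypothesis alpha_dual : forall k l,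
  oint (alephL alephG alephGs k) (complexify (alpha l)) = (k == l)%:R.

Implicit Types a b : {ffun M -> R[i]^o}.

Let n := (g + g)%N.
(* The periods along the first and the last 2g cycles of the double. *)
Let P (k : 'I_n) a := oint (alephL alephG alephGs (lshift n k)) a.
Let Q (k : 'I_n) a := oint (alephL alephG alephGs (rshift n k)) a.
Let E k := complexify (alpha k).
Let El (k : 'I_n) := E (lshift n k).
Let Er (k : 'I_n) := E (rshift n k).

Lemma oint_lin (c : M -> int) (x : R[i]) a b :
  oint c (x *: a + b) = x * oint c a + oint c b.
Proof.
rewrite /oint [x * _]mulrCA -mulrDr; congr (_ * _); rewrite mulr_sumr -big_split.
by apply: eq_bigr => d _; rewrite !ffunE /GRing.scale /=; ring.
Qed.

Lemma ointB (c : M -> int) a b : oint c (a - b) = oint c a - oint c b.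
Proof. by rewrite addrC -scaleN1r oint_lin mulN1r addrC. Qed.

Lemma oint0 (c : M -> int) : oint c (0 : {ffun M -> R[i]^o}) = 0.
Proof. by rewrite /oint big1 ?mulr0 // => d _; rewrite ffunE mulr0. Qed.

Lemma oint_sum (c : M -> int) (I : finType) (x : I -> R[i]) (u : I -> {ffun M -> R[i]^o}) :
  oint c (\sum_i x i *: u i) = \sum_i x i * oint c (u i).
Proof.
by elim/big_rec2: _ => [|i y a _ <-]; [exact: oint0 | exact: oint_lin].
Qed.

Lemma bilinear_closed a b :
    form1 a -> closed_form a -> form1 b -> closed_form b ->
  2^-1 * \sum_d a d * b (face d) = \sum_k (P k a * Q k b - Q k a * P k b).
Proof.
move=> a1 ac b1 bc.
exact: (bilinear_double (K := R[i]) aleph_dissection alephG_cycle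
  alephG_homologous alephGs_cycle alephGs_homologous (A := a) (B := b)).
Qed.

Lemma P_El k l : P k (El l) = (k == l)%:R.
Proof. by rewrite /P alpha_dual eq_lshift. Qed.
Lemma P_Er k l : P k (Er l) = 0.
Proof. by rewrite /P alpha_dual eq_lrshift. Qed.
Lemma Q_El k l : Q k (El l) = 0.
Proof. by rewrite /Q alpha_dual eq_rlshift. Qed.
Lemma Q_Er k l : Q k (Er l) = (k == l)%:R.
Proof. by rewrite /Q alpha_dual eq_rshift. Qed.

(** For a holomorphic form, (a, a) is -i times the wedge product of the conjugate
    of a with a, which the bilinear relation expresses by products each
    containing a P-period of a or its conjugate. *)
Lemma holomorphic_eq0 a : holomorphic rho a -> (forall k, P k a = 0) -> a = 0.
Proof.
move=> [a1 ac ah] Pa; apply: (sum_norm_eq0 rho_conformal).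
pose b : {ffun M -> R[i]^o} := [ffun d => (a d)^*].
have b1 : form1 b by move=> d; rewrite !ffunE a1 rmorphN.
have bc : closed_form b.
  move=> d; under eq_bigr => e _ do rewrite ffunE.
  by rewrite -rmorph_sum ac rmorph0.
have Pb k : P k b = 0.
  rewrite -[RHS]conjc0 -(Pa k) /P /oint rmorphM fmorphV rmorph_nat rmorph_sum.
  congr (_ * _); apply: eq_bigr => d _.
  by rewrite rmorphM rmorph_int ffunE.
have := bilinear_closed b1 bc a1 ac.
rewrite [RHS]big1 => [|k _]; last by rewrite Pa Pb mul0r mulr0 subrr.
move=> /eqP; rewrite mulf_eq0 invr_eq0 pnatr_eq0 /= => /eqP ba0.
apply: etrans (mulr0 (- 'i%C)); rewrite -[X in _ = _ * X]ba0 mulr_sumr.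
apply: eq_bigr => d _.
by rewrite -(hodge_face rho_conformal d a1) ah !ffunE /GRing.scale /=; ring.
Qed.

(* The Gram matrix has real entries, as the alpha_k are real. *)
Let Gr : 'M[R]_(n + n) :=
  \matrix_(k, l) (2^-1 * \sum_d rho d * alpha k d * alpha l d).

Lemma gramE k l : sprod rho (E k) (E l) = (Gr k l)%:C.
Proof.
rewrite mxE rmorphM fmorphV rmorph_nat rmorph_sum; congr (_ * _).
apply: eq_bigr => d _; rewrite !ffunE !rmorphM; congr (_ * _); exact: conjc_real.
Qed.

Lemma gram_sym : Gr^T = Gr.
Proof.
apply/matrixP => k l; rewrite !mxE; congr (_ * _).
by apply: eq_bigr => d _; rewrite mulrAC.
Qed.

(** The scalar product of alpha_k and alpha_l is the wedge product of alpha_k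
    with the star of alpha_l. *)
Lemma gram_period k l : (Gr k l)%:C =
  \sum_j (P j (E k) * Q j (hodge rho (E l)) - Q j (E k) * P j (hodge rho (E l))).
Proof.
have [k1 kc _] := alpha_harmonic k.
have [l1 _ _] := alpha_harmonic l.
have [hl1 hlc _] := harmonic_hodge rho_conformal (alpha_harmonic l).
rewrite -bilinear_closed // mxE rmorphM fmorphV rmorph_nat rmorph_sum.
congr (_ * _); apply: eq_bigr => d _; rewrite (hodge_face rho_conformal d l1).
by rewrite !ffunE !rmorphM /= mulrCA mulrA.
Qed.

Let Br := dlsubmx Gr.
Let Cr := drsubmx Gr.

Let BrE k l : Br k l = Gr (rshift n k) (lshift n l).
Proof. by rewrite !mxE. Qed.

Let CrE k l : Cr k l = Gr (rshift n k) (rshift n l).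
Proof. by rewrite !mxE. Qed.

Lemma P_hodge_El k l : P k (hodge rho (El l)) = - (Br k l)%:C.
Proof.
rewrite BrE gram_period (bigD1 k) //= big1 => [|j jk].
  by rewrite P_Er Q_Er eqxx mul0r mul1r sub0r addr0 opprK.
by rewrite P_Er Q_Er (negPf jk) !mul0r subrr.
Qed.

Lemma P_hodge_Er k l : P k (hodge rho (Er l)) = - (Cr k l)%:C.
Proof.
rewrite CrE gram_period (bigD1 k) //= big1 => [|j jk].
  by rewrite P_Er Q_Er eqxx mul0r mul1r sub0r addr0 opprK.
by rewrite P_Er Q_Er (negPf jk) !mul0r subrr.
Qed.

Lemma Q_hodge_Er k l : Q k (hodge rho (Er l)) = (Br l k)%:C.
Proof.
rewrite BrE -gram_sym [Gr^T _ _]mxE gram_period (bigD1 k) //= big1 => [|j jk].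
  by rewrite P_El Q_El eqxx mul0r mul1r subr0 addr0.
by rewrite P_El Q_El (negPf jk) !mul0r subrr.
Qed.

Lemma Cr_sym : Cr^T = Cr.
Proof. by rewrite trmx_drsub gram_sym. Qed.

(** The quadratic form is the squared norm of a combination s of the last 2g
    forms alpha; if s is zero, its Q-periods, which are the coefficients,
    vanish. *)
Lemma Cr_pos : posdefmx Cr.
Proof.
move=> v v0; pose s d : R := \sum_k v k 0 * alpha (rshift n k) d.
have -> : (v^T *m Cr *m v) 0 0 = 2^-1 * \sum_d rho d * s d ^+ 2.
  have -> : (v^T *m Cr *m v) 0 0 = \sum_l \sum_k v k 0 * Cr k l * v l 0.
    rewrite mxE; apply: eq_bigr => l _; rewrite mxE mulr_suml.
    by apply: eq_bigr => k _; rewrite mxE.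
  rewrite mulr_sumr exchange_big /=.
  rewrite (eq_bigr (fun k => \sum_d \sum_l 2^-1 * (rho d *
      ((v k 0 * alpha (rshift n k) d) * (v l 0 * alpha (rshift n l) d))))).
    rewrite exchange_big; apply: eq_bigr => d _.
    rewrite expr2 [in RHS]/s big_distrlr /= !mulr_sumr; apply: eq_bigr => k _.
    by rewrite !mulr_sumr.
  move=> k _; rewrite exchange_big; apply: eq_bigr => l _.
  rewrite CrE mxE [LHS]mulrAC mulrA mulr_sumr.
  by apply: eq_bigr => d _; ring.
have [rho_gt0 _ _] := rho_conformal.
rewrite mulr_gt0 ?invr_gt0 ?ltr0n // lt_neqAle sumr_ge0 ?andbT; last first.
  by move=> d _; rewrite mulr_ge0 ?sqr_ge0 // ltW.
apply: contraNneq v0 => /esym/eqP; rewrite psumr_eq0 => [/allP s0|d _]; last first.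
  by rewrite mulr_ge0 ?sqr_ge0 // ltW.
have {}s0 d : s d = 0.
  have := s0 d (mem_index_enum d).
  by rewrite /= mulf_eq0 gt_eqF //= expf_eq0 /= => /eqP.
have sE : \sum_k (v k 0)%:C *: Er k = 0.
  apply/ffunP => d; rewrite sum_ffunE ffunE.
  have := congr1 (real_complex R) (s0 d); rewrite rmorph_sum => /(etrans _); apply.
  by apply: eq_bigr => k _; rewrite !ffunE rmorphM.
apply/eqP/matrixP => k j; rewrite ord1 mxE; apply: complexI.
have := oint_sum (alephL alephG alephGs (rshift n k)) (fun k => (v k 0)%:C) Er.
rewrite sE (bigD1 k) //= big1 => [|l lk].
  by rewrite -/(Q k (Er k)) Q_Er eqxx mulr1 addr0 oint0 => <-.
by rewrite -/(Q k (Er l)) Q_Er eq_sym (negPf lk) mulr0.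
Qed.

(** The wedge product of two of the last 2g forms alpha is zero, as their
    P-periods are; so is the wedge product of their stars, whose periods are the
    entries of B and C. *)
Lemma Br_Cr : Br *m Cr = Cr *m Br^T.
Proof.
apply/matrixP => k l.
have [k1 kc _] := alpha_harmonic (rshift n k).
have [l1 lc _] := alpha_harmonic (rshift n l).
have [hk1 hkc _] := harmonic_hodge rho_conformal (alpha_harmonic (rshift n k)).
have [hl1 hlc _] := harmonic_hodge rho_conformal (alpha_harmonic (rshift n l)).
have := bilinear_closed hl1 hlc hk1 hkc.
rewrite (sum_hodge rho_conformal) // bilinear_closed // big1 => [|j _]; last first.
  by rewrite P_Er P_Er mul0r mulr0 subrr.
under eq_bigr => j _ do rewrite !P_hodge_Er !Q_hodge_Er.
move/esym/eqP; under eq_bigr => j _ do rewrite !mulrN mulNr -!rmorphM opprK addrC.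
rewrite sumrB -!rmorph_sum subr_eq0 => /eqP/complexI CB.
rewrite [LHS]mxE [RHS]mxE.
transitivity (\sum_i Cr i l * Br k i).
  by apply: eq_bigr => i _; rewrite mulrC.
rewrite -CB; apply: eq_bigr => i _.
by rewrite -[in RHS]Cr_sym !mxE mulrC.
Qed.

Let B := map_mx (real_complex R) Br.
Let C := map_mx (real_complex R) Cr.
Let Pi := invmx C *m (('i%C)%:M - B).
Let zeta (k : 'I_n) :=
  let s := \sum_l invmx C k l *: Er l in 'i%C *: s - hodge rho s.

Lemma Cr_unit : Cr \in unitmx. Proof. exact: posdefmx_unit Cr_pos. Qed.

Lemma C_unit : C \in unitmx. Proof. by rewrite map_unitmx Cr_unit. Qed.

(** Multiplied by C on both sides, the symmetry of Pi is [Br_Cr]. *)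
Lemma Pi_sym : Pi^T = Pi.
Proof.
have C_sym : C^T = C by rewrite /C map_trmx Cr_sym.
rewrite /Pi trmx_mul trmx_inv C_sym linearB /= tr_scalar_mx.
apply: (can_inj (mulKmx C_unit)); rewrite mulKVmx ?C_unit // mulmxA.
apply: (can_inj (mulmxK C_unit)); rewrite mulmxKV ?C_unit //.
rewrite mulmxBr mulmxBl scalar_mxC; congr (_ - _).
by rewrite /B /C map_trmx -!map_mxM Br_Cr.
Qed.

Lemma Im_Pi : map_mx (@complex.Im R) Pi = invmx Cr.
Proof.
rewrite /Pi mulmxBr -map_invmx mul_mx_scalar -map_mxM.
by apply/matrixP => k l; rewrite !mxE /=; ring.
Qed.

Lemma oint_zeta (c : M -> int) k : oint c (zeta k) =
  \sum_l invmx C k l * ('i%C * oint c (Er l) - oint c (hodge rho (Er l))).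
Proof.
have -> : zeta k = \sum_l invmx C k l *: ('i%C *: Er l - hodge rho (Er l)).
  rewrite /zeta hodge_sum scaler_sumr -sumrB; apply: eq_bigr => l _.
  by rewrite scalerBr !scalerA [_ * 'i%C]mulrC.
rewrite oint_sum; apply: eq_bigr => l _; congr (_ * _).
by rewrite ointB -[_ *: Er l]addr0 oint_lin oint0 addr0.
Qed.

Lemma P_zeta j k : P j (zeta k) = (j == k)%:R.
Proof.
have -> : (j == k)%:R = (invmx C *m C) k j by rewrite mulVmx ?C_unit // mxE eq_sym.
rewrite /P oint_zeta mxE; apply: eq_bigr => l _.
rewrite -/(P j (Er l)) -/(P j (hodge rho (Er l))) P_Er P_hodge_Er mulr0 sub0r opprK.
by rewrite -Cr_sym !mxE.
Qed.

Lemma Q_zeta j k : Q j (zeta k) = Pi j k.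
Proof.
rewrite -Pi_sym mxE /Q oint_zeta mxE; apply: eq_bigr => l _.
rewrite -/(Q j (Er l)) -/(Q j (hodge rho (Er l))) Q_Er Q_hodge_Er !mxE eq_sym.
by rewrite mulr_natr.
Qed.

Lemma zeta_holomorphic k : holomorphic rho (zeta k).
Proof.
apply: harmonic_holomorphic => //; elim/big_rec: _ => [|l a _ ha].
  exact: harmonic0.
by apply: harmonic_lin (alpha_harmonic _) ha.
Qed.

Lemma zeta_basis : is_basis (holomorphic rho) zeta.
Proof.
apply: (@dual_basis _ _ _ _ _ P).
- exact: holomorphic0.
- by move=> x a b; exact: holomorphic_lin.
- by move=> j x a b; exact: oint_lin.
- exact: zeta_holomorphic.
- exact: P_zeta.
- by move=> a; exact: holomorphic_eq0.
Qed.

End PeriodMatrix.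

Unset Implicit Arguments.
Set Strict Implicit.
Set Printing Implicit Defensive.

Theorem proposition3p3 (R : realType) (M : quadmap) (g : nat) (rho : M -> R)
    (aleph alephG alephGs : 'I_(g + g) -> M -> int)
    (alpha : 'I_((g + g) + (g + g)) -> {ffun M -> R^o})
    (genusM : has_genus M g)
    (rho_conformal : conformal rho)
    (aleph_dissection : canonical_dissection aleph)
    (alephG_cycle : forall k, Gamma_cycle true (alephG k))
    (alephG_homologous : forall k, homologous true (aleph k) (alephG k))
    (alephGs_cycle : forall k, Gamma_cycle false (alephGs k))
    (alephGs_homologous : forall k, homologous false (aleph k) (alephGs k))
    (alpha_basis : is_basis (real_harmonic rho) alpha)
    (alpha_dual : forall k l,
       oint (alephL alephG alephGs k) (complexify (alpha l)) = (k == l)%:R) :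
  let gram : 'M[R[i]]_((g + g) + (g + g)) :=
    \matrix_(k, l) sprod rho (complexify (alpha k)) (complexify (alpha l)) in
  let B : 'M[R[i]]_(g + g) := dlsubmx gram in
  let C : 'M[R[i]]_(g + g) := drsubmx gram in
  let Pi : 'M[R[i]]_(g + g) := invmx C *m (('i%C)%:M - B) in
  let zeta (k : 'I_(g + g)) : {ffun M -> R[i]^o} :=
    let s := \sum_l invmx C k l *: complexify (alpha (rshift (g + g) l)) in
    'i%C *: s - hodge rho s in
  [/\ C \in unitmx,
      is_basis (holomorphic rho) zeta,
      forall k l : 'I_(g + g),
        oint (alephL alephG alephGs (lshift (g + g) k)) (zeta l) = (k == l)%:R
        /\ oint (alephL alephG alephGs (rshift (g + g) k)) (zeta l) = Pi k l
    & Pi^T = Pi /\ posdefmx (map_mx (@complex.Im R) Pi)].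
Proof.
have [_ alpha_span] := alpha_basis.
have alpha_harmonic k : harmonic rho (complexify (alpha k)).
  apply/alpha_span/memv_span; apply/tnthP; exists k.
  by rewrite tnth_mktuple.
move=> gram.
have -> : gram = map_mx (real_complex R) (\matrix_(k, l)
    (2^-1 * \sum_d rho d * alpha k d * alpha l d)).
  by apply/matrixP => k l; rewrite mxE gramE [RHS]mxE.
rewrite -map_dlsubmx -map_drsubmx => B C Pi zeta.
split; first exact: C_unit rho_conformal alpha_dual.
- exact: zeta_basis rho_conformal aleph_dissection alephG_cycle alephG_homologous
    alephGs_cycle alephGs_homologous alpha_harmonic alpha_dual.
- move=> k l; split.
    exact: (P_zeta rho_conformal aleph_dissection alephG_cycle alephG_homologous
      alephGs_cycle alephGs_homologous alpha_harmonic alpha_dual).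
  exact: (Q_zeta rho_conformal aleph_dissection alephG_cycle alephG_homologous
    alephGs_cycle alephGs_homologous alpha_harmonic alpha_dual).
- split.
    exact: (Pi_sym rho_conformal aleph_dissection alephG_cycle alephG_homologous
      alephGs_cycle alephGs_homologous alpha_harmonic alpha_dual).
  rewrite Im_Pi; apply: posdefmx_inv (Cr_sym _ _).
  exact: Cr_pos rho_conformal alpha_dual.
Qed.
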